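(* Let $K=\mathbb{R}$ or $K=\mathbb{C}$. Let $G=G_1\cup G_2$ be a bipartite clique sum of bipartite graphs $G_1,G_2$ along a complete bipartite graph $K_{m,n}$. If $\max\{\operatorname{mtr}_K(G_1),\operatorname{mtr}_K(G_2)\}\ge\max\{m,n\}$, then $$\operatorname{mtr}_K(G)=\max\{\operatorname{mtr}_K(G_1),\operatorname{mtr}_K(G_2)\}.$$
   Context: A bipartite graph $H=(R\cup C,E)$ is finite, with parts $R$ (indexing rows) and $C$ (indexing columns) and edge set $E\subseteq R\times C$. For $K\in\{\mathbb{R},\mathbb{C}\}$, an $H$-partial matrix over $K$ is a vector $M=(M_{ij})_{(i,j)\in E}\in K^E$. A completion of $M$ over $K$ is an $|R|\times|C|$ matrix $A$ with entries in $K$, rows indexed by $R$ and columns by $C$, with $A_{ij}=M_{ij}$ for all $(i,j)\in E$. The $K$-completion rank of $M$ is the smallest rank of a completion of $M$ over $K$. An integer $r$ is a typical completion rank of $H$ over $K$ if the set of $M\in K^E$ with $K$-completion rank $r$ has nonempty interior in the Euclidean topology. $\operatorname{mtr}_K(H)$ denotes the maximum typical completion rank of $H$ over $K$; for $K=\mathbb{C}$ there is only one typical rank, so $\operatorname{mtr}_{\mathbb{C}}(H)$ is the generic completion rank of $H$, i.e. the unique integer that is the complex completion rank of all $M$ in some nonempty Zariski-open subset of $\mathbb{C}^E$. A bipartite clique sum of bipartite graphs $G_1=(R_1\cup C_1,E_1)$ and $G_2=(R_2\cup C_2,E_2)$ along $K_{m,n}$ is a graph obtained by gluing $G_1$ and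 $G_2$ along a common complete bipartite subgraph $K_{m,n}$ (compatibly with the bipartitions): after identification, $G=G_1\cup G_2=((R_1\cup R_2)\cup(C_1\cup C_2),E_1\cup E_2)$, where $|R_1\cap R_2|=m$, $|C_1\cap C_2|=n$ and $(R_1\cap R_2)\times(C_1\cap C_2)\subseteq E_1\cap E_2$. *)

(* Defs.v *)
From HB Require Import structures.
From mathcomp Require Import all_boot all_order all_algebra.
From mathcomp Require Import all_classical all_reals all_analysis.
From mathcomp Require Export complex.

Set Implicit Arguments.
Unset Strict Implicit.
Unset Printing Implicit Defensive.

Import Order.TTheory GRing.Theory Num.Theory.
Import numFieldNormedType.Exports.

Local Open Scope classical_set_scope.
Local Open Scope ring_scope.

(* The vertex classes are subsets of ambient finite types, one for rows and
   one for columns, so that graphs can share vertices and be glued by taking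
   unions. *)
Record bigraph (I J : finType) := BiGraph {
  rows : {set I};
  cols : {set J};
  edges : {set I * J};
  edges_sub : edges \subset finset.setX rows cols
}.

Section PartialMatrices.
Variables (K : numFieldType) (I J : finType) (H : bigraph I J).

(* K^E with the product topology; as E is finite, it is the Euclidean one. *)
Definition partial_matrix :=
  prod_topology (fun _ : {e : I * J | e \in edges H} => K).

Definition is_completion (M : partial_matrix)
    (A : 'M[K]_(#|rows H|, #|cols H|)) : Prop :=
  forall i j (ij : (enum_val i, enum_val j) \in edges H),
    A i j = M (exist _ (enum_val i, enum_val j) ij).

Definition has_completion_of_rank (M : partial_matrix) : pred nat :=
  fun r => `[< exists2 A, is_completion M A & \rank A = r >].

Lemma has_completion_of_rank_ex (M : partial_matrix) :
  exists r, has_completion_of_rank M r.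
Proof.
pose A : 'M[K]_(#|rows H|, #|cols H|) := \matrix_(i, j)
  oapp (M : {e : I * J | e \in edges H} -> K) 0
       (insub (enum_val i, enum_val j)).
exists (\rank A); apply/asboolP; exists A => // i j ij.
by rewrite mxE insubT.
Qed.

Definition completion_rank (M : partial_matrix) : nat :=
  ex_minn (has_completion_of_rank_ex M).

Definition typical_completion_rank (r : nat) : Prop :=
  [set M : partial_matrix | completion_rank M = r]^° !=set0.

Lemma typical_completion_rank_bound (r : nat) :
  typical_completion_rank r -> (r <= minn #|rows H| #|cols H|)%N.
Proof.
case=> M /interior_subset /= <-; rewrite /completion_rank.
case: ex_minnP => s /asboolP[A _ <-] _.
by rewrite leq_min rank_leq_row rank_leq_col.
Qed.

(* By typical_completion_rank_bound, the range contains every typical rank.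
   A typical rank exists over R and over C (sets of constant completion rank
   are semialgebraic, resp. constructible, and finitely many of them cover
   K^E), so this is a maximum over a nonempty set.  Over C the typical rank is
   unique and is the generic completion rank. *)
Definition mtr : nat :=
  \max_(r < (minn #|rows H| #|cols H|).+1 | `[< typical_completion_rank r >]) r.

End PartialMatrices.

Section CliqueSum.
Variables (I J : finType).

Lemma bigraph_union_sub (G1 G2 : bigraph I J) :
  edges G1 :|: edges G2 \subset
    finset.setX (rows G1 :|: rows G2) (cols G1 :|: cols G2).
Proof.
apply/fintype.subsetP => -[i j]; rewrite !inE /=.
by case/orP => [/(fintype.subsetP (edges_sub G1))
               |/(fintype.subsetP (edges_sub G2))];
  rewrite !inE /= => /andP[-> ->]; rewrite ?orbT.
Qed.

Definition bigraph_union (G1 G2 : bigraph I J) : bigraph I J :=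
  BiGraph (bigraph_union_sub G1 G2).

Definition bipartite_clique_sum (m n : nat) (G G1 G2 : bigraph I J) : Prop :=
  [/\ G = bigraph_union G1 G2,
      #|rows G1 :&: rows G2| = m,
      #|cols G1 :&: cols G2| = n &
      finset.setX (rows G1 :&: rows G2) (cols G1 :&: cols G2)
        \subset edges G1 :&: edges G2].

End CliqueSum.

(* Main.v *)
Require Import Defs.
From mathcomp Require Import all_boot all_order all_algebra.
From mathcomp Require Import all_classical all_reals all_analysis.
From mathcomp Require Import complex.
From mathcomp Require Import ordered_qelim qe_rcf closed_field.

Import Order.TTheory GRing.Theory Num.Theory.
Import numFieldNormedType.Exports.

Set Implicit Arguments.
Unset Strict Implicit.
Unset Printing Implicit Defensive.

Local Open Scope classical_set_scope.
Local Open Scope ring_scope.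

(** Write [r] for the larger of the two maximal typical ranks, [S] and [T] for
    the shared rows and columns.

    A partial matrix has completion rank at most [r] exactly when its entries
    are scalar products [p_i . q_j] of vectors of [K^r].  Call the factorization
    framed when the vectors [p_i], [i] in [S], are linearly independent, and so
    are the vectors [q_j], [j] in [T]; this is where [|S|, |T| <= r] is used.
    Two framed factorizations, one over [G1] and one over [G2], that agree on
    the fully specified block [S x T] differ on it by a change of basis [g] of
    [K^r] ([frames_conjugate]): a pair (full row rank [P], full column rank [Q])
    is determined by the product [P Q] up to [(P g, g^-1 Q)], whatever the rank
    of that product.  After this change of basis the two factorizations glue to
    one over [G], so [G] has completion rank at most [r] there
    ([glue_factorizations]).

    It remains to see that framed factorizations exist near every point, in the
    strong sense that each nonempty open set contains a nonempty open set of
    partial matrices having one ([open_framed_factorization]).  The obstacle is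
    that a set such as [completion rank <= r] could a priori be dense with empty
    interior.  Quantifier elimination rules this out: over the reals and over
    the complex numbers a set defined by a first-order formula is a boolean
    combination of polynomial conditions, and each of these has a constant truth
    value near every point of a dense open set.  Hence every nonempty open set
    contains a nonempty open set that lies inside or outside a given definable
    set: definable sets are [tame].  For such sets density on an open set
    implies nonempty interior.  Taking the least [s] such that [completion
    rank <= s] has interior in a given open set then shows that [s] is typical,
    so that [s <= mtr] ([open_rank_le]); and framed factorizations are dense
    among all factorizations, by a small translation of the vectors.

    Finally [mtr H1 <= mtr H] for a subgraph [H1] of [H], because restricting a
    partial matrix cannot increase its completion rank ([mtr_monotone]). *)

(** * Sets that are open or co-open near generic points *)

Lemma continuous_to_prod (K : numFieldType) (X : Type) (T : topologicalType)
    (f : T -> {ptws X -> K}) :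
  (forall i, continuous (fun t => f t i)) -> continuous f.
Proof.
move=> cf t; apply/cvg_sup => i.
by apply: continuous_comp_initial; exact: cf.
Qed.

(** Equivalently, the boundary of [S] is nowhere dense; this form is the one
    in which boolean combinations and density arguments are immediate. *)
Definition tame (T : topologicalType) (S : set T) : Prop :=
  forall U : set T, open U -> U !=set0 ->
    exists V, [/\ open V, V !=set0, V `<=` U & V `<=` S \/ V `<=` ~` S].

Section Tame.
Variable T : topologicalType.
Implicit Types S : set T.

Lemma tameC S : tame S -> tame (~` S).
Proof.
move=> tS U oU /(tS U oU)[V [oV V0 VU VS]]; exists V; split => //.
by case: VS; [right; rewrite setCK | left].
Qed.

Lemma tameI S1 S2 : tame S1 -> tame S2 -> tame (S1 `&` S2).
Proof.
move=> tS1 tS2 U oU /(tS1 U oU)[V [oV V0 VU [VS|VS]]]; last first.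
  by exists V; split => //; right => x /VS nS1 [].
have [W [oW W0 WV WS]] := tS2 V oV V0; exists W; split => //.
  exact: subset_trans VU.
case: WS => WS; [left => x Wx; split | right => x /WS nS2 []//].
  exact/VS/WV.
exact: WS.
Qed.

Lemma tameU S1 S2 : tame S1 -> tame S2 -> tame (S1 `|` S2).
Proof.
move=> tS1 tS2; rewrite -(setCK (_ `|` _)) setCU.
by apply/tameC/tameI; apply/tameC.
Qed.

Lemma tameT : tame [set: T].
Proof. by move=> U oU U0; exists U; split => //; left. Qed.

Lemma tame0 : tame (@set0 T).
Proof. by rewrite -setCT; exact/tameC/tameT. Qed.

Lemma tame_cond (P : Prop) : tame [set _ : T | P].
Proof.
have [p|np] := pselect P.
  by rewrite (_ : [set _ | _] = setT); [exact: tameT | by apply/seteqP; split].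
by rewrite (_ : [set _ | _] = set0); [exact: tame0 | by apply/seteqP; split].
Qed.

End Tame.

(** Each neighbourhood of [0] contains more points [e / (k + 2)] than a nonzero
    polynomial has roots. *)
Lemma small_nonroot (K : numFieldType) (p : {poly K}) (U : set K) :
  p != 0 -> nbhs 0 U -> exists2 s, U s & ~~ root p s.
Proof.
move=> p0 /nbhs_ballP[e /= e0 eU].
pose rs := [seq e / k.+2%:R | k <- iota 0 (size p)].
have rsU s : s \in rs -> U s.
  case/mapP=> k _ ->; apply: eU; rewrite -ball_normE /= sub0r normrN.
  rewrite ger0_norm; last by rewrite divr_ge0 ?ler0n ?ltW.
  by rewrite ltr_pdivrMr ?ltr0n// ltr_pMr// ltr1n.
have [/allP rsp|] := boolP (all (root p) rs).
  suff /(max_poly_roots p0 (introT allP rsp)) : uniq rs.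
    by rewrite size_map size_iota ltnn.
  rewrite map_inj_uniq ?iota_uniq// => i j.
  by move=> /(mulfI (lt0r_neq0 e0))/invr_inj/eqP; rewrite eqr_nat => /eqP[].
by case/allPn => s srs ns; exists s => //; exact: rsU.
Qed.

(** * Polynomial conditions *)

Section Terms.
Variables (K : numFieldType) (X : finType).
Implicit Types (x y : {ptws X -> K}) (t : GRing.term K).

(** The variable [X_n] of a formula stands for the coordinate of rank [n]. *)
Definition env (x : X -> K) : seq K := [seq x i | i <- enum X].

Lemma continuous_eval t :
  GRing.rterm t -> continuous (fun x : {ptws X -> K} => GRing.eval (env x) t).
Proof.
elim: t => //=.
- move=> n _; rewrite /env; elim: (enum X) n => [|i s IHs] [|n] /=;
    try exact: cst_continuous.
  + exact: proj_continuous.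
  + exact: IHs.
- by move=> c _; exact: cst_continuous.
- by move=> n _; exact: cst_continuous.
- move=> t1 IH1 t2 IH2 /andP[r1 r2] x.
  by apply: continuousD; [exact: IH1 | exact: IH2].
- by move=> t1 IH1 r1 x; apply: continuousN; exact: IH1.
- move=> t1 IH1 n r1 x; elim: n => [|n IHn]; first exact: cst_continuous.
  rewrite (_ : (fun y => _) =
    (fun y => GRing.eval (env y) t1) + (fun y => GRing.eval (env y) t1 *+ n)).
    by apply: continuousD; [exact: IH1 | exact: IHn].
  by apply/funext => y; rewrite mulrS.
- move=> t1 IH1 t2 IH2 /andP[r1 r2] x.
  by apply: continuousM; [exact: IH1 | exact: IH2].
- move=> t1 IH1 n r1 x; elim: n => [|n IHn]; first exact: cst_continuous.
  rewrite (_ : (fun y => _) =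
    (fun y => GRing.eval (env y) t1) \* (fun y => GRing.eval (env y) t1 ^+ n)).
    by apply: continuousM; [exact: IH1 | exact: IHn].
  by apply/funext => y; rewrite exprS.
Qed.

Lemma eval_along_line t x y : GRing.rterm t ->
  exists p : {poly K}, forall s,
    GRing.eval (env (fun i => x i + s * y i)) t = p.[s].
Proof.
elim: t => //=.
- move=> n _; rewrite /env; elim: (enum X) n => [|i r IHr] [|n] /=;
    try by exists 0 => s; rewrite horner0.
  + by exists ((x i)%:P + (y i) *: 'X) => s; rewrite !hornerE mulrC.
  + exact: IHr.
- by move=> c _; exists c%:P => s; rewrite hornerC.
- by move=> n _; exists n%:R%:P => s; rewrite hornerC.
- move=> t1 IH1 t2 IH2 /andP[/IH1[p1 E1] /IH2[p2 E2]].
  by exists (p1 + p2) => s; rewrite hornerD E1 E2.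
- by move=> t1 IH1 /IH1[p1 E1]; exists (- p1) => s; rewrite hornerN E1.
- by move=> t1 IH1 n /IH1[p1 E1]; exists (p1 *+ n) => s; rewrite hornerMn E1.
- move=> t1 IH1 t2 IH2 /andP[/IH1[p1 E1] /IH2[p2 E2]].
  by exists (p1 * p2) => s; rewrite hornerM E1 E2.
- by move=> t1 IH1 n /IH1[p1 E1]; exists (p1 ^+ n) => s; rewrite horner_exp E1.
Qed.

Lemma nbhs_along_line x y (U : set {ptws X -> K}) : open U -> U x ->
  nbhs 0 [set s : K | U (fun i => x i + s * y i)].
Proof.
move=> oU Ux.
have cl : continuous (fun s : K => (fun i => x i + s * y i) : {ptws X -> K}).
  apply: continuous_to_prod => i s.
  have cid : continuous (@id K) by move=> u; exact: cvg_id.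
  have ccst (c : K) : continuous (fun _ : K => c) by exact: cst_continuous.
  exact: (continuousD (@ccst (x i) s) (continuousM (cid s) (@ccst (y i) s))).
  apply: (cl 0); rewrite (_ : (fun i => _) = x); last first.
  by apply: funext => i; rewrite mul0r addr0.
exact: open_nbhs_nbhs.
Qed.

(** A polynomial function that is nonzero at one point [y0] is nonzero at points
    arbitrarily close to any [x]: on the line through [x] and [y0] it is a
    nonzero polynomial in one variable. *)
Lemma eval_eq0_dichotomy t : GRing.rterm t ->
  (forall x, GRing.eval (env x) t = 0) \/
  (forall U : set {ptws X -> K}, open U -> U !=set0 ->
     exists V, [/\ open V, V !=set0, V `<=` U &
                   forall x, V x -> GRing.eval (env x) t != 0]).
Proof.
move=> rt; have [?|] := pselect (forall x, GRing.eval (env x) t = 0).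
  by left.
move/existsNP => [y0 /eqP ty0]; right => U oU [x Ux].
have [p Ep] := eval_along_line x (fun i => y0 i - x i) rt.
have p0 : p != 0.
  apply: contraNneq ty0 => p0; move: (Ep 1); rewrite p0 horner0 => <-.
  by apply/eqP; congr GRing.eval; apply: eq_map => i; rewrite mul1r addrC subrK.
have [s Us nps] := small_nonroot p0
  (nbhs_along_line (fun i => y0 i - x i) oU Ux).
exists (U `&` [set x | GRing.eval (env x) t != 0]); split.
- apply: openI => //; apply: (@open_comp _ _ _ [set c : K | c != 0]).
    by move=> z _; exact: continuous_eval.
  rewrite (_ : [set c : K | c != 0] = ~` [set 0]); last first.
    by apply/seteqP; split => c /= /eqP.
  apply/closed_openC/accessible_closed_set1/hausdorff_accessible.
  exact: norm_hausdorff.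
- by eexists; split; [exact: Us | rewrite /= Ep].
- by move=> z [].
- by move=> z [].
Qed.

Lemma tame_eval_eq0 t : GRing.rterm t ->
  tame [set x : {ptws X -> K} | GRing.eval (env x) t = 0].
Proof.
case/eval_eq0_dichotomy => [t0 U oU U0|dt U oU /(dt U oU)[V [oV V0 VU Vt]]].
  by exists U; split => //; left => x _; exact: t0.
by exists V; split => //; right => x /Vt/eqP.
Qed.

Lemma tame_eval_eq t1 t2 : GRing.rterm t1 -> GRing.rterm t2 ->
  tame [set x : {ptws X -> K} | GRing.eval (env x) t1 = GRing.eval (env x) t2].
Proof.
move=> r1 r2.
have := @tame_eval_eq0 (GRing.Add t1 (GRing.Opp t2)).
rewrite /= r1 r2 => /(_ isT).
congr tame; apply/funext => x /=; apply/propext.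
by split => [/eqP|->]; rewrite ?subrr// subr_eq0 => /eqP.
Qed.

Lemma tame_qf (f : GRing.formula K) : GRing.qf_form f -> GRing.rformula f ->
  tame [set x : {ptws X -> K} | GRing.qf_eval (env x) f].
Proof.
elim: f => //=.
- by move=> b _ _; exact: tame_cond.
- move=> t1 t2 _ /andP[r1 r2].
  have := tame_eval_eq r1 r2; congr tame.
  by apply/funext => x; apply/propext; split => [/eqP|/eqP].
- move=> f1 IH1 f2 IH2 /andP[q1 q2] /andP[r1 r2].
  have := tameI (IH1 q1 r1) (IH2 q2 r2); congr tame.
  by apply/funext => x; apply/propext; split => /andP.
- move=> f1 IH1 f2 IH2 /andP[q1 q2] /andP[r1 r2].
  have := tameU (IH1 q1 r1) (IH2 q2 r2); congr tame.
  by apply/funext => x; apply/propext; split => /orP.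
- move=> f1 IH1 f2 IH2 /andP[q1 q2] /andP[r1 r2].
  have := tameU (tameC (IH1 q1 r1)) (IH2 q2 r2); congr tame.
  apply/funext => x; apply/propext; rewrite /= implybE; split.
    by case=> [/negP ->|->]; rewrite ?orbT.
  by case/orP => [/negP|]; [left | right].
- move=> f1 IH1 q1 r1; have := tameC (IH1 q1 r1); congr tame.
  by apply/funext => x; apply/propext; split => /negP.
Qed.

End Terms.

(** * Definable sets over the real and complex numbers *)

(** The only property of the field on which the argument depends. *)
Definition definable_sets_tame (K : numFieldType) : Prop :=
  forall (X : finType) (f : GRing.formula K), GRing.rformula f ->
    tame [set x : {ptws X -> K} | GRing.holds (env x) f].

Lemma complex_definable_sets_tame (R : realType) : definable_sets_tame R[i].
Proof.
move=> X f rf.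
have wf := @ClosedFieldQE.wf_ex_elim R[i].
have ok := @ClosedFieldQE.holds_ex_elim R[i] (@solve_monicpoly R[i]).
have /andP[q r] := GRing.quantifier_elim_wf wf rf.
have := tame_qf (X := X) q r; congr tame.
apply/funext => x; apply/propext.
by split => /(GRing.quantifier_elim_rformP wf ok _ rf).
Qed.

Section Ordered.
Variables (R : realType) (X : finType).
Local Notation K := (R : numFieldType).
Implicit Types (t : GRing.term R).

Lemma tame_eval_lt t1 t2 : GRing.rterm t1 -> GRing.rterm t2 ->
  tame [set x : {ptws X -> K} | GRing.eval (env x) t1 < GRing.eval (env x) t2].
Proof.
move=> r1 r2; pose t : GRing.term K := GRing.Add t1 (GRing.Opp t2).
have rt : GRing.rterm t by rewrite /= r1 r2.
have [t0 U oU U0|dt U oU /(dt U oU)[V [oV V0 VU Vt]]] :=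
  eval_eq0_dichotomy X rt.
  exists U; split => //; right => x _ /=.
  by have /= := t0 x; move/eqP; rewrite subr_eq0 => /eqP ->; rewrite ltxx.
pose N := [set x : {ptws X -> K} | GRing.eval (env x) t < 0].
have oN : open N.
  apply: (@open_comp _ _ _ [set c : K | c < 0]); last exact: open_lt.
  by move=> z _; exact: continuous_eval.
have [VN|VN] := pselect (V `&` N !=set0).
  exists (V `&` N); split => //; first exact: openI.
    by move=> x [/VU].
  by left => x [_]; rewrite /N /= subr_lt0.
exists V; split => //; right => x Vx /= lt12; apply: VN; exists x; split => //.
by rewrite /N /= subr_lt0.
Qed.

Lemma tame_ord_qf (f : ord.formula R) : ord.qf_form f -> ord.rformula f ->
  tame [set x : {ptws X -> K} | ord.qf_eval (env x) f].
Proof.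
elim: f => //=.
- by move=> b _ _; exact: tame_cond.
- move=> t1 t2 _ /andP[r1 r2].
  have := tame_eval_eq (K := R) (X := X) r1 r2; congr tame.
  by apply/funext => x; apply/propext; split => [/eqP|/eqP].
- by move=> t1 t2 _ /andP[r1 r2]; exact: tame_eval_lt.
- move=> t1 t2 _ /andP[r1 r2].
  have := tameC (tame_eval_lt r2 r1); congr tame.
  by apply/funext => x; apply/propext; rewrite /= leNgt; split => /negP.
- move=> f1 IH1 f2 IH2 /andP[q1 q2] /andP[r1 r2].
  have := tameI (IH1 q1 r1) (IH2 q2 r2); congr tame.
  by apply/funext => x; apply/propext; split => /andP.
- move=> f1 IH1 f2 IH2 /andP[q1 q2] /andP[r1 r2].
  have := tameU (IH1 q1 r1) (IH2 q2 r2); congr tame.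
  by apply/funext => x; apply/propext; split => /orP.
- move=> f1 IH1 f2 IH2 /andP[q1 q2] /andP[r1 r2].
  have := tameU (tameC (IH1 q1 r1)) (IH2 q2 r2); congr tame.
  apply/funext => x; apply/propext; rewrite /= implybE; split.
    by case=> [/negP ->|->]; rewrite ?orbT.
  by case/orP => [/negP|]; [left | right].
- move=> f1 IH1 q1 r1; have := tameC (IH1 q1 r1); congr tame.
  by apply/funext => x; apply/propext; split => /negP.
Qed.

End Ordered.

(** Elimination over a real closed field needs the order in its output, so it
    applies to the larger language of ordered rings. *)
Fixpoint ord_formula (K : Type) (f : GRing.formula K) : ord.formula K :=
  match f with
  | GRing.Bool b => ord.Bool b
  | GRing.Equal t1 t2 => ord.Equal t1 t2
  | GRing.Unit t => ord.Unit t
  | GRing.And f1 f2 => ord.And (ord_formula f1) (ord_formula f2)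
  | GRing.Or f1 f2 => ord.Or (ord_formula f1) (ord_formula f2)
  | GRing.Implies f1 f2 => ord.Implies (ord_formula f1) (ord_formula f2)
  | GRing.Not f1 => ord.Not (ord_formula f1)
  | GRing.Exists i f1 => ord.Exists i (ord_formula f1)
  | GRing.Forall i f1 => ord.Forall i (ord_formula f1)
  end.

Lemma holds_ord_formula (K : realDomainType) (f : GRing.formula K) (e : seq K) :
  ord.holds e (ord_formula f) <-> GRing.holds e f.
Proof.
elim: f e => //= [f IHf g IHg e|f IHf g IHg e|f IHf g IHg e|f IHf e
                 |i f IHf e|i f IHf e].
- by rewrite IHf IHg.
- by rewrite IHf IHg.
- by rewrite IHf IHg.
- by rewrite IHf.
- by split=> -[x] /IHf; exists x.
- by split=> H x; apply/IHf.
Qed.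

Lemma rformula_ord_formula (K : realDomainType) (f : GRing.formula K) :
  ord.rformula (ord_formula f) = GRing.rformula f.
Proof. by elim: f => //= [f -> g ->|f -> g ->|f -> g ->]. Qed.

Lemma real_definable_sets_tame (R : realType) : definable_sets_tame R.
Proof.
move=> X f rf.
have rof : ord.rformula (ord_formula f) by rewrite rformula_ord_formula.
have /andP[q r] := ord.quantifier_elim_wf (@wf_QE_wproj R) rof.
have := tame_ord_qf (X := X) q r; congr tame.
apply/funext => x; apply/propext; rewrite /= -holds_ord_formula.
by split => /(ord.quantifier_elim_rformP
  (@wf_QE_wproj R) (@valid_QE_wproj R) _ rof).
Qed.

(** * Sets defined by systems of polynomial equations *)

Definition dot (K : pzRingType) r (u v : 'rV[K]_r) : K := \sum_k u 0 k * v 0 k.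

Section Systems.
Variables (K : numFieldType) (X Y : finType).
Hypothesis tameK : definable_sets_tame K.

Lemma nth_env (Z : finType) (x : Z -> K) (i : Z) : (env x)`_(enum_rank i) = x i.
Proof. by rewrite (nth_map i) ?nth_enum_rank// -cardE ltn_ord. Qed.

Lemma size_env (Z : finType) (x : Z -> K) : size (env x) = #|Z|.
Proof. by rewrite size_map -cardE. Qed.

(** In the formula, the coordinates of [x] are the variables below [#|X|], and
    the unknowns [y] the existentially quantified ones that follow. *)
Lemma tame_projection (ts : seq (GRing.term K)) : all (@GRing.rterm K) ts ->
  tame [set x : {ptws X -> K} | exists y : Y -> K,
          all (fun t => GRing.eval (env x ++ env y) t == 0) ts].
Proof.
move=> rts.
pose f := foldr (fun t g => GRing.And (GRing.Equal t (GRing.Const 0)) g)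
  (GRing.Bool true) ts.
have rf : GRing.rformula (foldr GRing.Exists f (iota #|X| #|Y|)).
  have rf : GRing.rformula f.
    by elim: ts rts @f => //= t s IHs /andP[-> /IHs ->].
  by elim: (iota _ _).
have fE e : GRing.holds e f <-> all (fun t => GRing.eval e t == 0) ts.
  rewrite /f; elim: (ts) => //= t s [IH1 IH2]; split.
    by case=> -> /IH1 ->; rewrite eqxx.
  by case/andP => /eqP -> /IH2.
have := tameK (X := X) rf; congr tame; apply/funext => x; apply/propext => /=.
rewrite -GRing.foldExistsP; split => [[e ee /fE fe]|[y fy]].
  exists (fun j => e`_(#|X| + enum_rank j)).
  move: fe; apply: sub_all => t /eqP et0; apply/eqP.
  rewrite -[RHS]et0; apply: GRing.eq_eval => n; rewrite nth_cat size_env.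
  have [nX|Xn] := ltnP n #|X|.
    by rewrite -ee// !inE mem_iota leqNgt nX.
  have [nY|Yn] := ltnP (n - #|X|) #|Y|.
    have -> : (n - #|X|)%N = enum_rank (enum_val (Ordinal nY)).
      by rewrite enum_valK.
    by rewrite nth_env enum_valK /= subnKC.
  rewrite nth_default ?size_env// -ee ?nth_default ?size_env//.
  by rewrite !inE mem_iota negb_and -!leqNgt -leq_subRL// Yn orbT.
exists (env x ++ env y); last exact/fE.
move=> n; rewrite !inE mem_iota nth_cat size_env.
have [//|Xn /=] := ltnP n #|X|; rewrite -leqNgt => n_large.
rewrite !nth_default ?size_env//.
by rewrite leq_subRL.
Qed.

End Systems.

(** Existence of vectors with prescribed scalar products, some of which are
    coordinates of [x]: rank factorizations and linear independence are both of
    this form. *)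
Lemma tame_dot_system (K : numFieldType) (X V : finType) r
    (eqs : seq (V * V * (X + K))) : definable_sets_tame K ->
  tame [set x : {ptws X -> K} | exists w : V -> 'rV[K]_r,
    all (fun c => dot (w c.1.1) (w c.1.2) ==
                  match c.2 with inl i => x i | inr a => a end) eqs].
Proof.
move=> tameK.
pose var (u : V) (k : 'I_r) := GRing.Var K (#|X| + enum_rank (u, k)).
pose dotT (u v : V) :=
  \big[GRing.Add/GRing.Const 0]_(k < r) GRing.Mul (var u k) (var v k).
pose rhsT (c : X + K) := match c with
  inl i => GRing.Var K (enum_rank i) | inr a => GRing.Const a end.
pose eqT (c : V * V * (X + K)) :=
  GRing.Add (dotT c.1.1 c.1.2) (GRing.Opp (rhsT c.2)).
have rdotT u v : GRing.rterm (dotT u v) 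
    by rewrite /dotT; elim/big_ind: _ => //= t1 t2 -> ->.
have reqT : all (@GRing.rterm K) (map eqT eqs).
  by rewrite all_map; apply/allP => c _ /=; rewrite rdotT; case: c.2.
have := @tame_projection K X (V * 'I_r)%type tameK _ reqT; congr tame.
apply/funext => x; apply/propext => /=.
have evalE (w : V -> 'rV[K]_r) (y : V * 'I_r -> K) c :
    (forall u k, y (u, k) = w u 0 k) ->
    (GRing.eval (env x ++ env y) (eqT c) == 0) =
    (dot (w c.1.1) (w c.1.2) == match c.2 with inl i => x i | inr a => a end).
  move=> yw; rewrite -[RHS]subr_eq0 /eqT /=; congr (_ - _ == _); last first.
    case: c.2 => //= i; rewrite nth_cat size_env ltn_ord; exact: nth_env.
  rewrite /dotT (big_morph (GRing.eval _) (id1 := 0) (op1 := +%R))//.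
  apply: eq_bigr => k _ /=.
  by rewrite !nth_cat size_env !ltnNge !leq_addr /= !addKn !nth_env !yw.
split=> [[y]|[w]] H.
  exists (fun u => \row_k y (u, k)).
  apply: etrans H; rewrite all_map; apply: eq_all => c /=.
  by rewrite (evalE (fun u => \row_k y (u, k)))// => u k; rewrite mxE.
exists (fun uk => w uk.1 0 uk.2).
apply: etrans H; rewrite all_map; apply: eq_all => c /=.
by rewrite (evalE w).
Qed.

(** * Uniqueness of factorizations up to a change of basis *)

Lemma right_invertible_normal_form (K : fieldType) m k
    (P : 'M[K]_(m, m + k)) (L : 'M[K]_(m + k, m)) : P *m L = 1%:M ->
  exists2 u, u \in unitmx & P = row_mx 1%:M 0 *m u.
Proof.
move=> PL.
have fP : row_full P^T.
  by apply/row_fullP; exists L^T; rewrite -trmx_mul PL trmx1.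
have f1 : row_full (col_mx 1%:M 0 : 'M[K]_(m + k, m)).
  apply/row_fullP; exists (row_mx 1%:M 0).
  by rewrite mul_row_col mulmx1 mul0mx addr0.
have /eqmxMunitP[u uu Pu] : (P^T == (col_mx 1%:M 0 : 'M[K]_(m + k, m)))%MS.
  by rewrite !submx_full.
exists u^T; first by rewrite unitmx_tr.
by rewrite -[LHS]trmxK Pu trmx_mul tr_col_mx trmx1 trmx0.
Qed.

(** By [right_invertible_normal_form] one may assume that [P1 = P2] projects to
    the first [m] coordinates, so that [Q1 = (B; Y1)] and [Q2 = (B; Y2)] have
    the same top block [B].  As these are injective, so are [Y1] and [Y2] on the
    kernel of [B]; hence [Y1 = h Y2] there for some invertible [h], and [Y1]
    and [h Y2] differ by some [a B].  The block triangular matrix with rows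
    [(1, 0)] and [(a, h)] is the required change of basis. *)
Lemma framed_factorizations_conjugate (K : fieldType) m n r
    (P1 P2 : 'M[K]_(m, r)) (Q1 Q2 : 'M[K]_(r, n))
    (L1 L2 : 'M[K]_(r, m)) (N1 N2 : 'M[K]_(n, r)) :
    P1 *m L1 = 1%:M -> P2 *m L2 = 1%:M ->
    N1 *m Q1 = 1%:M -> N2 *m Q2 = 1%:M -> P1 *m Q1 = P2 *m Q2 ->
  exists2 g, g \in unitmx & P2 = P1 *m g /\ Q1 = g *m Q2.
Proof.
move=> PL1 PL2 NQ1 NQ2 PQ.
have [k rE] : exists k, r = (m + k)%N.
  by exists (r - m)%N; rewrite subnKC// (mulmx1_min PL1).
subst r.
have [u1 uu1 P1E] := right_invertible_normal_form PL1.
have [u2 uu2 P2E] := right_invertible_normal_form PL2.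
pose Y1 := dsubmx (u1 *m Q1); pose Y2 := dsubmx (u2 *m Q2).
pose B := usubmx (u1 *m Q1).
have E1 : u1 *m Q1 = col_mx B Y1 by rewrite vsubmxK.
have E2 : u2 *m Q2 = col_mx B Y2.
  rewrite -[LHS]vsubmxK; congr col_mx; rewrite /B.
  move: PQ; rewrite P1E P2E -!mulmxA -[u1 *m Q1]vsubmxK -[u2 *m Q2]vsubmxK.
  by rewrite !mul_row_col !mul1mx !mul0mx !addr0 !col_mxKu.
(* The columns of [cokermx B] span the kernel of [B]. *)
have full_on_kernel u (Q : 'M[K]_(m + k, n)) N Y :
    u \in unitmx -> N *m Q = 1%:M ->
    u *m Q = col_mx B Y -> (Y *m cokermx B == cokermx B)%MS.
  move=> uu NQ E; rewrite submxMl /=; apply/submxP.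
  exists (rsubmx (N *m invmx u)); rewrite mulmxA.
  have : N *m invmx u *m (u *m Q) = 1%:M by rewrite mulmxA mulmxKV.
  rewrite E -{1}[N *m invmx u]hsubmxK mul_row_col.
  move=> /(congr1 (mulmx^~ (cokermx B))).
  by rewrite mulmxDl -!mulmxA mulmx_coker mulmx0 add0r mul1mx mulmxA => ->.
have /eqmxMunitP[h uh Yh] : (Y1 *m cokermx B == Y2 *m cokermx B)%MS.
  have /eqmxP e1 := full_on_kernel _ _ _ _ uu1 NQ1 E1.
  have /eqmxP e2 := full_on_kernel _ _ _ _ uu2 NQ2 E2.
  by apply/eqmxP; exact: eqmx_trans e1 (eqmx_sym e2).
have /submxP[a aE] : (Y1 - h *m Y2 <= B)%MS.
  by rewrite submxE mulmxBl -mulmxA Yh subrr.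
pose g := block_mx 1%:M 0 a h.
have ug : g \in unitmx by rewrite unitmxE det_lblock det1 mul1r -unitmxE.
exists (invmx u1 *m g *m u2).
  by rewrite !unitmx_mul unitmx_inv uu1 ug uu2.
split.
  rewrite P1E P2E !mulmxA mulmxK// /g.
  by rewrite mul_row_block !mul1mx !mul0mx !addr0.
apply: (can_inj (mulKmx uu1)); rewrite -!mulmxA mulKVmx// E2 E1 /g.
by rewrite mul_block_col mul1mx mul0mx addr0 -aE subrK.
Qed.

Section Dot.
Variable K : fieldType.
Implicit Types r : nat.

Lemma dotE r (u v : 'rV[K]_r) : dot u v = (u *m v^T) 0 0.
Proof. by rewrite mxE; apply: eq_bigr => k _; rewrite mxE. Qed.

Lemma dot_matrix (I J : Type) a b r (p : I -> 'rV[K]_r) (q : J -> 'rV[K]_r)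
    (f : 'I_a -> I) (h : 'I_b -> J) :
  (\matrix_i p (f i)) *m (\matrix_j q (h j))^T =
  \matrix_(i, j) dot (p (f i)) (q (h j)).
Proof.
by apply/matrixP => i j; rewrite !mxE; apply: eq_bigr => k _; rewrite !mxE.
Qed.

Lemma dot_adjoint r (u v : 'rV[K]_r) (g : 'M[K]_r) : g \in unitmx ->
  dot (u *m g) (v *m (invmx g)^T) = dot u v.
Proof. by move=> ug; rewrite !dotE trmx_mul trmxK mulmxA mulmxK. Qed.

Lemma frames_conjugate (I J : finType) (S : {set I}) (T : {set J}) r
    (p1 p2 p1' p2' : I -> 'rV[K]_r) (q1 q2 q1' q2' : J -> 'rV[K]_r) :
    {in S &, forall i i', dot (p1 i) (p1' i') = (i == i')%:R} ->
    {in S &, forall i i', dot (p2 i) (p2' i') = (i == i')%:R} ->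
    {in T &, forall j j', dot (q1 j) (q1' j') = (j == j')%:R} ->
    {in T &, forall j j', dot (q2 j) (q2' j') = (j == j')%:R} ->
    (forall i j, i \in S -> j \in T -> dot (p1 i) (q1 j) = dot (p2 i) (q2 j)) ->
  exists2 g : 'M[K]_r, g \in unitmx &
    {in S, forall i, p2 i = p1 i *m g} /\
    {in T, forall j, q2 j = q1 j *m (invmx g)^T}.
Proof.
move=> d1 d2 c1 c2 pq.
pose Pm (p : I -> 'rV[K]_r) := \matrix_(a < #|S|) p (enum_val a).
pose Qm (q : J -> 'rV[K]_r) := \matrix_(b < #|T|) q (enum_val b).
have frameP p p' : {in S &, forall i i', dot (p i) (p' i') = (i == i')%:R} ->
    Pm p *m (Pm p')^T = 1%:M.
  move=> d; rewrite dot_matrix; apply/matrixP => a b.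
  by rewrite !mxE d ?enum_valP// (inj_eq enum_val_inj).
have frameQ q q' : {in T &, forall j j', dot (q j) (q' j') = (j == j')%:R} ->
    Qm q' *m (Qm q)^T = 1%:M.
  move=> d; rewrite -[LHS]trmxK trmx_mul trmxK dot_matrix; apply/matrixP => a b.
  by rewrite !mxE d ?enum_valP// (inj_eq enum_val_inj) eq_sym.
have PQ : Pm p1 *m (Qm q1)^T = Pm p2 *m (Qm q2)^T.
  by rewrite !dot_matrix; apply/matrixP => a b; rewrite !mxE pq ?enum_valP.
have [g ug [Pg Qg]] := framed_factorizations_conjugate
  (frameP _ _ d1) (frameP _ _ d2) (frameQ _ _ c1) (frameQ _ _ c2) PQ.
exists g => //; split=> [i iS|j jT].
  have := congr1 (row (enum_rank_in iS i)) Pg.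
  by rewrite row_mul !rowK enum_rankK_in.
have := congr1 (fun A => row (enum_rank_in jT j) (invmx g *m A)^T) Qg.
by rewrite /= mulKmx// trmx_mul !trmxK row_mul !rowK enum_rankK_in.
Qed.

End Dot.

(** * Framed families of vectors *)

Section Frames.
Variables (K : fieldType) (r : nat).
Implicit Types u v : 'rV[K]_r.

(** Linear independence, expressed by a dual family [p'] so that it is a system
    of equations in scalar products. *)
Definition framed (I : finType) (S : {set I}) (p : I -> 'rV[K]_r) : Prop :=
  exists p', {in S &, forall i i', dot (p i) (p' i') = (i == i')%:R}.

Lemma dotC u v : dot u v = dot v u.
Proof. by apply: eq_bigr => k _; rewrite mulrC. Qed.

Lemma dot_translate u u0 v (s : K) :
  dot (u + s *: u0) v = dot u v + s * dot u0 v.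
Proof.
rewrite mulr_sumr -big_split; apply: eq_bigr => k _.
by rewrite !mxE mulrDl mulrA.
Qed.

Lemma framed_of_right_inverse (I : finType) (S : {set I}) (p : I -> 'rV[K]_r)
    (L : 'M[K]_(r, #|S|)) :
  (\matrix_(a < #|S|) p (enum_val a)) *m L = 1%:M -> framed S p.
Proof.
move=> pL; exists (fun i => if [pick a : 'I_(#|S|) | enum_val a == i] is Some a
                   then (col a L)^T else 0) => i i' iS i'S.
case: pickP => [b /eqP bi'|/(_ (enum_rank_in i'S i'))]; last first.
  by rewrite enum_rankK_in// eqxx.
rewrite dotE trmxK -bi' -(enum_rankK_in iS iS) (inj_eq enum_val_inj).
have := congr1 (fun A : 'M[K]_(#|S|) => A (enum_rank_in iS i) b) pL.
rewrite [in RHS]mxE => <-; rewrite !mxE; apply: eq_bigr => k _.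
by rewrite !mxE.
Qed.

(** Take for [p0] distinct unit vectors on [S].  Then a maximal minor of the
    family [p + s p0] has the form [det (B + s)], so it vanishes only if [- s]
    is an eigenvalue of [B]. *)
Lemma framed_generic_translate (I : finType) (S : {set I}) (p : I -> 'rV[K]_r) :
  (#|S| <= r)%N -> exists (p0 : I -> 'rV[K]_r) (c : {poly K}), c != 0 /\
    forall s, ~~ root c s -> framed S (fun i => p i + s *: p0 i).
Proof.
move=> Sr; pose p0 i : 'rV[K]_r := \row_k (index i (enum S) == k)%:R.
pose P := \matrix_(a < #|S|) p (enum_val a).
pose B := P *m (pid_mx #|S| : 'M[K]_(r, #|S|)).
have P0 : \matrix_(a < #|S|) p0 (enum_val a) = pid_mx #|S|.
  apply/matrixP => a k; rewrite !mxE ltn_ord andbT (enum_val_nth (enum_val a)).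
  by rewrite index_uniq ?enum_uniq// -cardE.
exists p0, (char_poly (- B)).
split; first by rewrite monic_neq0 ?char_poly_monic.
move=> s; rewrite -eigenvalue_root_char /eigenvalue /eigenspace negbK => ker0.
have uW : B + s%:M \in unitmx.
  move: ker0; rewrite kermx_eq0 -opprD -row_free_unit /row_free.
  by rewrite (eqmx_opp (B + s%:M)).
apply: (@framed_of_right_inverse _ _ _ (pid_mx #|S| *m invmx (B + s%:M))).
rewrite mulmxA (_ : _ *m pid_mx _ = B + s%:M) ?mulmxV//.
have -> : \matrix_a (p (enum_val a) + s *: p0 (enum_val a)) =
    P + s *: pid_mx #|S|.
  by rewrite -P0; apply/matrixP => a k; rewrite !mxE.
by rewrite mulmxDl -scalemxAl pid_mx_id// pid_mx_1 scalemx1.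
Qed.

End Frames.

Lemma framed_perturbation (K : numFieldType) (X I : finType) (S : {set I}) r
    (f : X -> I) (v : X -> 'rV[K]_r) (p : I -> 'rV[K]_r)
    (U : set {ptws X -> K}) :
    (#|S| <= r)%N -> open U -> U (fun e => dot (p (f e)) (v e)) ->
  exists p1, framed S p1 /\ U (fun e => dot (p1 (f e)) (v e)).
Proof.
move=> Sr oU Up; have [p0 [c [c0 cP]]] := framed_generic_translate p Sr.
have [s Us ncs] := small_nonroot c0
  (nbhs_along_line (fun e => dot (p0 (f e)) (v e)) oU Up).
exists (fun i => p i + s *: p0 i); split; first exact: cP.
move: Us; rewrite /=; congr U; apply/funext => e; exact/esym/dot_translate.
Qed.

(** * Completion rank and factorizations *)

Section Factorizations.
Variables (K : numFieldType) (I J : finType) (H : bigraph I J).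
Implicit Types (M : partial_matrix K H) (r : nat) (S : {set I}) (T : {set J}).

Definition factors r M (p : I -> 'rV[K]_r) (q : J -> 'rV[K]_r) : Prop :=
  forall e, dot (p (val e).1) (q (val e).2) = M e.

Definition framed_factorization S T r M : Prop :=
  exists (p : I -> 'rV[K]_r) (q : J -> 'rV[K]_r),
    [/\ factors M p q, framed S p & framed T q].

Lemma completion_rank_leP r M :
  (completion_rank M <= r)%N <->
  exists (p : I -> 'rV[K]_r) (q : J -> 'rV[K]_r), factors M p q.
Proof.
rewrite /completion_rank; case: ex_minnP => n /asboolP[A AM rA] n_min; split.
  move=> nr; have [P [Q PQ]] : exists P Q, A = (P : 'M[K]_(_, r)) *m Q.
    exists (col_ebase A *m pid_mx n), (pid_mx n *m row_ebase A).
    by rewrite -rA mulmxA -(mulmxA (col_ebase A)) pid_mx_id ?mulmx_ebase ?rA.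
  pose p i := if [pick a : 'I_(#|rows H|) | enum_val a == i] is Some a
    then row a P else 0.
  pose q j := if [pick b : 'I_(#|cols H|) | enum_val b == j] is Some b
    then row b Q^T else 0.
  have pE a : p (enum_val a) = row a P.
    rewrite /p; case: pickP => [b /eqP/enum_val_inj -> //|/(_ a)].
    by rewrite eqxx.
  have qE b : q (enum_val b) = row b Q^T.
    rewrite /q; case: pickP => [c /eqP/enum_val_inj -> //|/(_ b)].
    by rewrite eqxx.
  exists p, q => -[[i j] ij] /=.
  have := fintype.subsetP (edges_sub H) _ ij; rewrite inE /= => /andP[iR jC].
  move: ij; rewrite -(enum_rankK_in iR iR) -(enum_rankK_in jC jC) => ij.
  rewrite pE qE -AM PQ dotE tr_row trmxK !mxE.
  by apply: eq_bigr => k _; rewrite !mxE.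
move=> [p [q pq]].
pose B := \matrix_(a < #|rows H|) p (enum_val a) *m
          (\matrix_(b < #|cols H|) q (enum_val b))^T.
apply: leq_trans (mulmx_max_rank _ _ : (\rank B <= r)%N).
apply: n_min; apply/asboolP; exists B => // a b ij.
by rewrite /B dot_matrix mxE (pq (exist (fun e => e \in edges H) _ ij)).
Qed.

Hypothesis tameK : definable_sets_tame K.

Lemma tame_framed_factorization S T r :
  tame [set M : partial_matrix K H | framed_factorization S T r M].
Proof.
pose X := {e : I * J | e \in edges H}.
pose V := ((I + J) + (I + J))%type.
pose eqs : seq (V * V * (X + K)) :=
  [seq (inl (inl (val e).1), inl (inr (val e).2), inl e) | e : X] ++
  [seq (inl (inl i), inr (inl i'), inr (i == i')%:R)
    | i <- enum S, i' <- enum S] ++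
  [seq (inl (inr j), inr (inr j'), inr (j == j')%:R)
    | j <- enum T, j' <- enum T].
have := tame_dot_system r eqs tameK; congr tame.
apply/funext => M; apply/propext => /=.
split=> [[w]|[p [q [pq [p' pp'] [q' qq']]]]].
  rewrite /eqs !all_cat => /and3P[/allP He /allP Hp /allP Hq].
  exists (fun i => w (inl (inl i))), (fun j => w (inl (inr j))); split.
  - move=> e; apply/eqP.
    apply: (He (inl (inl (val e).1), inl (inr (val e).2), inl e)).
    by rewrite map_f ?mem_enum.
  - exists (fun i => w (inr (inl i))) => i i' iS i'S; apply/eqP.
    apply: (Hp (inl (inl i), inr (inl i'), inr (i == i')%:R)).
    by apply: allpairs_f; rewrite mem_enum.
  - exists (fun j => w (inr (inr j))) => j j' jT j'T; apply/eqP.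
    apply: (Hq (inl (inr j), inr (inr j'), inr (j == j')%:R)).
    by apply: allpairs_f; rewrite mem_enum.
exists (fun x => match x with
  | inl (inl i) => p i | inl (inr j) => q j
  | inr (inl i) => p' i | inr (inr j) => q' j end).
rewrite /eqs !all_cat; apply/and3P; split; apply/allP => c.
- by case/mapP => e _ -> /=; rewrite pq.
- case/allpairsP => -[i i'] /=; rewrite !mem_enum => -[iS i'S ->] /=.
  by rewrite pp'.
- case/allpairsP => -[j j'] /=; rewrite !mem_enum => -[jT j'T ->] /=.
  by rewrite qq'.
Qed.

Lemma tame_completion_rank_le r :
  tame [set M : partial_matrix K H | (completion_rank M <= r)%N].
Proof.
have := tame_framed_factorization finset.set0 finset.set0 r; congr tame.
apply/funext => M; apply/propext; rewrite /= completion_rank_leP; split.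
  by case=> p [q [pq _ _]]; exists p, q.
case=> p [q pq]; exists p, q.
by split => //; exists (fun=> 0) => ? ?; rewrite inE.
Qed.

Lemma framed_factorization_dense S T r (U : set (partial_matrix K H)) :
    (#|S| <= r)%N -> (#|T| <= r)%N -> open U ->
    U `&` [set M | (completion_rank M <= r)%N] !=set0 ->
  U `&` framed_factorization S T r !=set0.
Proof.
move=> Sr Tr oU [M [UM /completion_rank_leP[p [q pq]]]].
have U1 : U (fun e => dot (p (val e).1) (q (val e).2)).
  by move: UM; congr U; apply/funext => e; rewrite -pq.
have [p1 [fp1 U2]] := framed_perturbation Sr oU U1.
have U3 : U (fun e => dot (q (val e).2) (p1 (val e).1)).
  by move: U2; congr U; apply/funext => e; rewrite dotC.
have [q1 [fq1 U4]] := framed_perturbation Tr oU U3.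
eexists; split; first exact: U4.
by exists p1, q1; split => // e; rewrite dotC.
Qed.

Lemma le_mtr r : typical_completion_rank K H r -> (r <= mtr K H)%N.
Proof.
move=> tr; have := typical_completion_rank_bound tr; rewrite -ltnS => rb.
by rewrite /mtr (bigD1 (Ordinal rb)) ?leq_maxl//; exact/asboolP.
Qed.

(** Stated with an inequality, so that it also covers the case where the maximum
    that defines [mtr] is the default value [0]. *)
Lemma open_rank_ge_mtr : exists U : set (partial_matrix K H),
  [/\ open U, U !=set0 & forall M, U M -> (mtr K H <= completion_rank M)%N].
Proof.
rewrite /mtr; elim/big_ind: _ => [|m n IHm IHn|i /asboolP[M Mi]].
- by exists setT; split => //; [exact: openT | exists (fun=> 0)].
- by case: (leqP m n).
- exists ([set M | completion_rank M = i]^°).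
  split; first exact: open_interior.
    by exists M.
  by move=> N /interior_subset ->.
Qed.

(** Let [s] be least such that [completion rank <= s] has interior in [U].  If
    [0 < s], the set [completion rank <= s - 1] is tame without interior in [U],
    so it misses an open part of the interior of the former; there the
    completion rank is [s], so [s] is typical and [s <= mtr <= r]. *)
Lemma open_rank_le r (U : set (partial_matrix K H)) : (mtr K H <= r)%N ->
    open U -> U !=set0 ->
  exists V, [/\ open V, V !=set0, V `<=` U &
             forall M, V M -> (completion_rank M <= r)%N].
Proof.
move=> mr oU U0.
pose good s := exists V, [/\ open V, V !=set0, V `<=` U &
             forall M, V M -> (completion_rank M <= s)%N].
have [n goodn] : exists n, good n.
  exists (minn #|rows H| #|cols H|), U; split => // M _.
  rewrite /completion_rank; case: ex_minnP => s /asboolP[A _ <-] _.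
  by rewrite leq_min rank_leq_row rank_leq_col.
elim: n goodn => [|n IHn] goodn.
  have [V [oV V0 VU Vn]] := goodn; exists V; split => // M /Vn.
  by rewrite leqn0 => /eqP ->.
have [nr|rn] := leqP n.+1 r.
  have [V [oV V0 VU Vn]] := goodn.
  by exists V; split => // M /Vn/leq_trans; exact.
have [V [oV V0 VU Vn]] := goodn.
have [W [oW W0 WV [Wle|Wgt]]] := tame_completion_rank_le n oV V0.
  by apply: IHn; exists W; split => //; exact: subset_trans VU.
suff /le_mtr : typical_completion_rank K H n.+1.
  by rewrite leqNgt (leq_ltn_trans mr).
have [M WM] := W0; exists M.
have : W `<=` [set M | completion_rank M = n.+1]; last first.
  by move=> Wn; rewrite /interior; apply: filterS Wn _; exact: open_nbhs_nbhs.
move=> N WN; apply/eqP; rewrite eqn_leq Vn; last exact: WV.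
by rewrite ltnNge; apply/negP; exact: Wgt.
Qed.

(** Framed factorizations are dense in an open set where the completion rank is
    at most [r]; being tame, they fill an open part of it. *)
Lemma open_framed_factorization S T r (U : set (partial_matrix K H)) :
    (mtr K H <= r)%N -> (#|S| <= r)%N -> (#|T| <= r)%N -> open U -> U !=set0 ->
  exists V, [/\ open V, V !=set0, V `<=` U & V `<=` framed_factorization S T r].
Proof.
move=> mr Sr Tr oU U0.
have [V [oV V0 VU Vr]] := open_rank_le mr oU U0.
have [W [oW W0 WV [Wf|Wnf]]] := @tame_framed_factorization S T r V oV V0.
  by exists W; split => //; exact: subset_trans VU.
have [|M [/Wnf nf f]] := framed_factorization_dense Sr Tr oW; last by [].
by have [M WM] := W0; exists M; split => //; apply/Vr/WV.
Qed.

End Factorizations.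

(** * Restriction to a subgraph *)

Section Restriction.
Variables (K : numFieldType) (I J : finType) (H1 H : bigraph I J).
Hypothesis sub : edges H1 \subset edges H.

Definition restrict (M : partial_matrix K H) : partial_matrix K H1 :=
  fun e => M (exist _ (val e) (fintype.subsetP sub _ (valP e))).

Definition overwrite (M : partial_matrix K H) (N : partial_matrix K H1) :
    partial_matrix K H :=
  fun e => if insub (val e) is Some e1 then N e1 else M e.

Lemma restrictE M (e1 : {e | e \in edges H1}) (e : {e | e \in edges H}) :
  val e1 = val e -> restrict M e1 = M e.
Proof. by move=> ee; congr M; exact: val_inj. Qed.

Lemma restrict_overwrite M N : restrict (overwrite M N) = N.
Proof. by apply/funext => e; rewrite /restrict /overwrite /= valK. Qed.

Lemma overwrite_restrict M : overwrite M (restrict M) = M.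
Proof.
apply/funext => e; rewrite /overwrite.
by case: insubP => // e1 _ /restrictE.
Qed.

Lemma continuous_restrict : continuous restrict.
Proof. by apply: continuous_to_prod => e; exact: proj_continuous. Qed.

Lemma continuous_overwrite M : continuous (overwrite M).
Proof.
apply: continuous_to_prod => e; rewrite /overwrite.
by case: insub => [e1|]; [exact: proj_continuous | exact: cst_continuous].
Qed.

(** Overwriting a point of [U] is a continuous section of the restriction map;
    it carries the open sets found below back into [U]. *)
Lemma restrict_preimage (D : set (partial_matrix K H1)) :
    (forall V, open V -> V !=set0 ->
       exists W, [/\ open W, W !=set0, W `<=` V & W `<=` D]) ->
  forall U, open U -> U !=set0 ->
    exists W, [/\ open W, W !=set0, W `<=` U & W `<=` restrict @^-1` D].
Proof.
move=> denseD U oU [M UM].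
have [||W [oW [N WN] WV WD]] := denseD (overwrite M @^-1` U).
- by apply: open_comp => // N _; exact: continuous_overwrite.
- by exists (restrict M); rewrite /= overwrite_restrict.
exists (U `&` restrict @^-1` W); split.
- apply: openI => //; apply: open_comp => // N' _; exact: continuous_restrict.
- by exists (overwrite M N); split; [exact: WV | rewrite /= restrict_overwrite].
- by move=> ? [].
- by move=> N' [_ /WD].
Qed.

Lemma completion_rank_restrict M :
  (completion_rank (restrict M) <= completion_rank M)%N.
Proof.
have /completion_rank_leP[p [q pq]] := leqnn (completion_rank M).
apply/completion_rank_leP; exists p, q => e.
exact: (pq (exist (fun e => e \in edges H) (val e)
                  (fintype.subsetP sub _ (valP e)))).
Qed.

Lemma mtr_monotone : definable_sets_tame K -> (mtr K H1 <= mtr K H)%N.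
Proof.
move=> tameK; have [U [oU [N UN] Uge]] := @open_rank_ge_mtr K _ _ H1.
have [||V [_ [M VM] VU Vle]] :=
  open_rank_le tameK (U := restrict @^-1` U) (leqnn (mtr K H)).
- by apply: open_comp => // M _; exact: continuous_restrict.
- by exists (overwrite (fun=> 0) N); rewrite /= restrict_overwrite.
apply: leq_trans (Vle _ VM); apply: leq_trans (completion_rank_restrict M).
by apply: Uge; exact: VU.
Qed.

End Restriction.

(** * Clique sums *)

Section CliqueSum.
Variables (K : numFieldType) (I J : finType) (G1 G2 : bigraph I J).
Let G := bigraph_union G1 G2.
Let S := rows G1 :&: rows G2.
Let T := cols G1 :&: cols G2.
Hypothesis clique : finset.setX S T \subset edges G1 :&: edges G2.

Let sub1 : edges G1 \subset edges G. Proof. exact: finset.subsetUl. Qed.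
Let sub2 : edges G2 \subset edges G. Proof. exact: finset.subsetUr. Qed.

(** On shared rows and columns the two families agree after the change of basis
    [g], which makes the case distinction below consistent on [G2]. *)
Lemma glue_factorizations r (M : partial_matrix K G) :
    framed_factorization S T r (restrict sub1 M) ->
    framed_factorization S T r (restrict sub2 M) ->
  (completion_rank M <= r)%N.
Proof.
move=> [p1 [q1 [pq1 [p1' fp1] [q1' fq1]]]] [p2 [q2 [pq2 [p2' fp2] [q2' fq2]]]].
have [|g ug [pg qg]] := frames_conjugate fp1 fp2 fq1 fq2.
  move=> i j iS jT; have ijST : (i, j) \in finset.setX S T by rewrite inE iS.
  have := fintype.subsetP clique _ ijST; rewrite inE => /andP[ij1 ij2].
  rewrite (pq1 (exist _ (i, j) ij1)) (pq2 (exist _ (i, j) ij2)).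
  exact: restrictE.
apply/completion_rank_leP.
exists (fun i => if i \in rows G1 then p1 i *m g else p2 i).
exists (fun j => if j \in cols G1 then q1 j *m (invmx g)^T else q2 j).
move=> -[[i j] ij] /=.
have [ij1|ij2] := finset.setUP ij.
  have := fintype.subsetP (edges_sub G1) _ ij1; rewrite inE /= => /andP[-> ->].
  by rewrite dot_adjoint// (pq1 (exist _ (i, j) ij1)); exact: restrictE.
have := fintype.subsetP (edges_sub G2) _ ij2; rewrite inE /= => /andP[iR jC].
have -> : (if i \in rows G1 then p1 i *m g else p2 i) = p2 i.
  by case: ifP => // i1; rewrite pg// inE i1.
have -> : (if j \in cols G1 then q1 j *m (invmx g)^T else q2 j) = q2 j.
  by case: ifP => // j1; rewrite qg// inE j1.
by rewrite (pq2 (exist _ (i, j) ij2)); exact: restrictE.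
Qed.

Lemma mtr_clique_sum : definable_sets_tame K ->
    (maxn #|S| #|T| <= maxn (mtr K G1) (mtr K G2))%N ->
  mtr K G = maxn (mtr K G1) (mtr K G2).
Proof.
move=> tameK; set r := maxn (mtr K G1) _; rewrite geq_max => /andP[Sr Tr].
apply/eqP; rewrite eqn_leq geq_max !mtr_monotone// !andbT.
have [U [oU U0 Uge]] := @open_rank_ge_mtr K _ _ G.
have r1 : (mtr K G1 <= r)%N by rewrite leq_maxl.
have r2 : (mtr K G2 <= r)%N by rewrite leq_maxr.
have [V1 [oV1 V10 V1U V1f]] := restrict_preimage sub1
  (fun V => open_framed_factorization tameK r1 Sr Tr (U := V)) oU U0.
have [V2 [_ [M V2M] V21 V2f]] := restrict_preimage sub2
  (fun V => open_framed_factorization tameK r2 Sr Tr (U := V)) oV1 V10.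
apply: leq_trans (Uge M _) _; first exact/V1U/V21.
by apply: glue_factorizations; [exact/V1f/V21 | exact: V2f].
Qed.

End CliqueSum.

Theorem theorem4p8 (R : realType) (I J : finType) (G G1 G2 : bigraph I J)
    (m n : nat) (HG : bipartite_clique_sum m n G G1 G2) :
  ((maxn m n <= maxn (mtr R G1) (mtr R G2))%N ->
     mtr R G = maxn (mtr R G1) (mtr R G2)) /\
  ((maxn m n <= maxn (mtr R[i] G1) (mtr R[i] G2))%N ->
     mtr R[i] G = maxn (mtr R[i] G1) (mtr R[i] G2)).
Proof.
case: HG => -> <- <- clique; split.
- exact: (@mtr_clique_sum R I J G1 G2 clique (@real_definable_sets_tame R)).
- exact: (@mtr_clique_sum R[i] I J G1 G2 clique
            (@complex_definable_sets_tame R)).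
Qed.
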